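(* Let $R$ be a commutative noetherian ring, $\mathfrak a$ an ideal of $R$ and $M$ a finitely generated $R$-module. If $r\ge 1$ is an integer such that $H^i_{\mathfrak a}(M)$ is a minimax module for all $i\ge r$, then $H^i_{\mathfrak a}(M)$ is an artinian module for all $i\ge r$.
   Context: $H^i_{\mathfrak a}(M)$ denotes the $i$-th local cohomology module of $M$ with respect to $\mathfrak a$. A module $M$ is minimax if it has a finitely generated submodule $N$ such that $M/N$ is artinian. *)

(* Defs.v *)
From HB Require Import structures.
From mathcomp Require Import all_boot all_order all_algebra.
From mathcomp Require Import boolp.

Set Implicit Arguments.
Unset Strict Implicit.
Unset Printing Implicit Defensive.

Import GRing.Theory.

Local Open Scope ring_scope.
Local Open Scope quotient_scope.

(* Submodules are mathcomp's [submodClosed V]: boolean predicates closed under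
   the module operations.  With the excluded middle of boolp (in the form
   [`[< P >]]) every submodule in the usual sense is of this form. *)

Section SubmoduleAsModule.
Variables (R : pzRingType) (V : lmodType R) (N : submodClosed V).

Record submod := Submod { submod_val : V; submod_valP : submod_val \in N }.

HB.instance Definition _ := [isSub for submod_val].
HB.instance Definition _ := [Choice of submod by <:].
HB.instance Definition _ := [SubChoice_isSubLmodule of submod by <:].

End SubmoduleAsModule.

Section QuotientModule.
Variables (R : pzRingType) (V : lmodType R) (N : submodClosed V).

Definition quot_pred : {pred V} := [pred x | x \in N].

Lemma quot_pred_zmod_closed : zmod_closed quot_pred.
Proof. exact: GRing.submod_closedB (submodClosedP N). Qed.

HB.instance Definition _ :=
  GRing.isZmodClosed.Build V quot_pred quot_pred_zmod_closed.

Definition quotmod : Type := Quotient.quot quot_pred.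

HB.instance Definition _ := EqQuotient.on quotmod.
HB.instance Definition _ := GRing.Zmodule.on quotmod.

Definition quotmod_proj (x : V) : quotmod := \pi_(Quotient.quot quot_pred) x.

Lemma quotmod_projK : cancel (repr : quotmod -> V) quotmod_proj.
Proof. exact: reprK. Qed.

Lemma quotmod_projE x y :
  (quotmod_proj x == quotmod_proj y) = (x - y \in N).
Proof. by rewrite -[RHS]/(x - y \in quot_pred) Quotient.idealrBE. Qed.

Lemma quotmod_projD : {morph quotmod_proj : x y / x + y}.
Proof. by move=> x y; rewrite /quotmod_proj piE. Qed.

Definition quotmod_scale (a : R) (q : quotmod) : quotmod :=
  quotmod_proj (a *: repr q).

Lemma quotmod_scaleE a x :
  quotmod_scale a (quotmod_proj x) = quotmod_proj (a *: x).
Proof.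
apply/eqP; rewrite quotmod_projE -scalerBr.
by apply: rpredZ; rewrite -quotmod_projE quotmod_projK.
Qed.

Lemma quotmod_scaleA a b q :
  quotmod_scale a (quotmod_scale b q) = quotmod_scale (a * b) q.
Proof. by rewrite -[q]quotmod_projK !quotmod_scaleE scalerA. Qed.

Lemma quotmod_scale1 : left_id 1 quotmod_scale.
Proof. by move=> q; rewrite -[q]quotmod_projK quotmod_scaleE scale1r. Qed.

Lemma quotmod_scaleDr : right_distributive quotmod_scale +%R.
Proof.
move=> a p q; rewrite -[p]quotmod_projK -[q]quotmod_projK.
by rewrite -quotmod_projD !quotmod_scaleE -quotmod_projD scalerDr.
Qed.

Lemma quotmod_scaleDl q : {morph quotmod_scale^~ q : a b / a + b}.
Proof.
move=> a b; rewrite -[q]quotmod_projK !quotmod_scaleE.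
by rewrite -quotmod_projD scalerDl.
Qed.

HB.instance Definition _ := GRing.Zmodule_isLmodule.Build R quotmod
  quotmod_scaleA quotmod_scale1 quotmod_scaleDr quotmod_scaleDl.

End QuotientModule.

Section FinitenessConditions.
Variable R : pzRingType.

Definition fin_gen (V : lmodType R) : Prop :=
  exists s : seq V, forall v : V,
    exists c : 'I_(size s) -> R, v = \sum_(i < size s) c i *: s`_i.

Definition artinian (V : lmodType R) : Prop :=
  forall N : nat -> submodClosed V,
    (forall k, {subset N k.+1 <= N k}) ->
    exists n, forall k, (n <= k)%N -> N k =i N n.

Definition minimax (V : lmodType R) : Prop :=
  exists N : submodClosed V, fin_gen (submod N) /\ artinian (quotmod N).

Definition injective_module (E : lmodType R) : Prop :=
  forall (A B : lmodType R) (f : {linear A -> B}) (g : {linear A -> E}),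
    injective f -> exists h : {linear B -> E}, forall x, h (f x) = g x.

End FinitenessConditions.

(* Mathcomp's own [idealr] excludes the unit ideal; ideals are here the
   submodules of the regular module, so that the unit ideal and the zero ring
   are allowed. *)
Notation ideal R := (submodClosed (R^o : lmodType R)).

Definition noetherian_ring (R : comPzRingType) : Prop :=
  forall I : ideal R, fin_gen (submod I).

Section IdealPowers.
Variable R : comPzRingType.

Definition ideal1_pred : {pred R^o} := predT.

Lemma ideal1_closed : subsemimod_closed ideal1_pred.
Proof. by []. Qed.

HB.instance Definition _ :=
  GRing.isSubmodClosed.Build R R^o ideal1_pred ideal1_closed.

Definition ideal1 : ideal R := ideal1_pred.

Definition ideal_mul_pred (I J : ideal R) : {pred R^o} := [pred z : R^o |
  `[< exists2 s : seq (R * R),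
        all (fun p => (p.1 \in I) && (p.2 \in J)) s
      & z = \sum_(p <- s) p.1 * p.2 >]].

Lemma ideal_mul_closed I J : subsemimod_closed (ideal_mul_pred I J).
Proof.
split; first split.
- by apply/asboolP; exists [::]; rewrite ?big_nil.
- move=> _ _ /asboolP[s sIJ ->] /asboolP[t tIJ ->]; apply/asboolP.
  by exists (s ++ t); rewrite ?all_cat ?sIJ ?big_cat.
- move=> a _ /asboolP[s sIJ ->]; apply/asboolP.
  exists [seq (a * p.1, p.2) | p <- s].
    rewrite all_map; apply: sub_all sIJ => p /= /andP[p1 ->]; rewrite andbT.
    exact: (@rpredZ _ _ I a _ p1).
  rewrite big_map -[LHS]/(a * _) mulr_sumr.
  by apply: eq_bigr => p _; rewrite mulrA.
Qed.

HB.instance Definition _ I J :=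
  GRing.isSubmodClosed.Build R R^o (ideal_mul_pred I J) (ideal_mul_closed I J).

Definition ideal_mul (I J : ideal R) : ideal R := ideal_mul_pred I J.

Fixpoint ideal_exp (I : ideal R) (n : nat) : ideal R :=
  if n is m.+1 then ideal_mul I (ideal_exp I m) else ideal1.

End IdealPowers.

Section TorsionFunctor.
Variables (R : comPzRingType) (a : ideal R).

Section Objects.
Variable V : lmodType R.

Definition killed_by_pow (n : nat) (v : V) : Prop :=
  forall r : R, r \in ideal_exp a n -> r *: v = 0.

Lemma killed_by_powW m n v :
  (m <= n)%N -> killed_by_pow m v -> killed_by_pow n v.
Proof.
move=> /subnK <-; elim: (n - m)%N => [//|k IHk] /IHk kill r /asboolP[s sP ->].
rewrite scaler_suml big_seq big1 // => p /(allP sP) /andP[_ /kill p2].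
by rewrite -scalerA p2 scaler0.
Qed.

Definition torsion_pred : {pred V} := [pred v | `[< exists n, killed_by_pow n v >]].

Lemma torsion_closed : subsemimod_closed torsion_pred.
Proof.
split; first split.
- by apply/asboolP; exists 0%N => r _; rewrite scaler0.
- move=> u v /asboolP[m um] /asboolP[n vn]; apply/asboolP.
  exists (maxn m n) => r ran; rewrite scalerDr.
  rewrite (killed_by_powW (leq_maxl m n) um) //.
  by rewrite (killed_by_powW (leq_maxr m n) vn) // addr0.
- move=> b v /asboolP[n vn]; apply/asboolP; exists n => r ran.
  by rewrite scalerA mulrC -scalerA vn // scaler0.
Qed.

HB.instance Definition _ :=
  GRing.isSubmodClosed.Build R V torsion_pred torsion_closed.

Definition torsion : lmodType R := submod torsion_pred.

End Objects.

Variables (V W : lmodType R) (f : {linear V -> W}).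

Lemma torsion_mapP (v : torsion V) : f (val v) \in @torsion_pred W.
Proof.
case: v => v /= /asboolP[n vn]; apply/asboolP; exists n => r ran.
by rewrite -linearZ vn // linear0.
Qed.

Definition torsion_map (v : torsion V) : torsion W := Submod (torsion_mapP v).

Lemma torsion_map_is_linear : linear torsion_map.
Proof. by move=> b u v; apply: val_inj; rewrite /= linearP. Qed.

HB.instance Definition _ :=
  GRing.isLinear.Build R (torsion V) (torsion W) _ torsion_map
    torsion_map_is_linear.

End TorsionFunctor.

Arguments torsion_map {R} a {V W} f v.

Record cochain_complex (R : pzRingType) := CochainComplex {
  cobj :> nat -> lmodType R;
  cdiff : forall i, {linear cobj i -> cobj i.+1};
  cdiffK : forall i x, cdiff i.+1 (cdiff i x) = 0
}.

Section Cohomology.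
Variables (R : pzRingType) (C : cochain_complex R).

Definition cocycle_pred i : {pred C i} := [pred x | cdiff C i x == 0].

Lemma cocycle_closed i : subsemimod_closed (@cocycle_pred i).
Proof.
split; first split.
- by rewrite inE linear0.
- by move=> x y; rewrite !inE linearD => /eqP-> /eqP->; rewrite addr0.
- by move=> b x; rewrite !inE linearZ_LR => /eqP->; rewrite scaler0.
Qed.

HB.instance Definition _ i :=
  GRing.isSubmodClosed.Build R (C i) (@cocycle_pred i) (@cocycle_closed i).

Definition cocycles i : lmodType R := submod (@cocycle_pred i).

(* The differential into degree 0 is zero. *)
Definition is_coboundary i : C i -> Prop :=
  match i return C i -> Prop with
  | 0 => fun x => x = 0
  | j.+1 => fun x => exists y, x = cdiff C j y
  end.

Definition coboundary_pred i : {pred cocycles i} :=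
  [pred z | `[< is_coboundary (val z) >]].

Lemma coboundary_closed i : subsemimod_closed (@coboundary_pred i).
Proof.
case: i => [|i]; split; try split.
- by apply/asboolP.
- by move=> x y /asboolP /= x0 /asboolP /= y0; apply/asboolP; rewrite /= x0 y0 addr0.
- by move=> b x /asboolP /= x0; apply/asboolP; rewrite /= x0 scaler0.
- by apply/asboolP; exists 0; rewrite linear0.
- move=> x y /asboolP[u xu] /asboolP[v yv]; apply/asboolP.
  by exists (u + v); rewrite linearD -xu -yv.
- move=> b x /asboolP[u xu]; apply/asboolP.
  by exists (b *: u); rewrite linearZ_LR -xu.
Qed.

HB.instance Definition _ i :=
  GRing.isSubmodClosed.Build R (cocycles i) (@coboundary_pred i)
    (@coboundary_closed i).

Definition cohomology i : lmodType R := quotmod (@coboundary_pred i).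

End Cohomology.

Section TorsionComplex.
Variables (R : comPzRingType) (a : ideal R) (C : cochain_complex R).

Lemma torsion_diffK i (x : torsion a (C i)) :
  torsion_map a (cdiff C i.+1) (torsion_map a (cdiff C i) x) = 0.
Proof. by apply: val_inj; rewrite /= cdiffK. Qed.

Definition torsion_complex : cochain_complex R :=
  @CochainComplex R (fun i => torsion a (C i))
    (fun i => torsion_map a (cdiff C i)) torsion_diffK.

End TorsionComplex.

Record injective_resolution (R : pzRingType) (M : lmodType R) :=
  InjectiveResolution {
    ires_complex :> cochain_complex R;
    ires_aug : {linear M -> ires_complex 0};
    ires_injective : forall i, injective_module (ires_complex i);
    ires_aug_inj : injective ires_aug;
    ires_exact0 : forall x,
      cdiff ires_complex 0 x = 0 <-> exists m, x = ires_aug m;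
    ires_exactS : forall i x,
      cdiff ires_complex i.+1 x = 0 <-> exists y, x = cdiff ires_complex i y
  }.

(* H^i_a(M) as the i-th right derived functor of the a-torsion functor,
   computed from a given injective resolution E of M; up to isomorphism it does
   not depend on E. *)
Definition local_cohomology (R : comPzRingType) (a : ideal R) (M : lmodType R)
    (E : injective_resolution M) (i : nat) : lmodType R :=
  cohomology (torsion_complex a E) i.

(* Main.v *)
Require Import Defs.
From HB Require Import structures.
From mathcomp Require Import all_boot all_order all_algebra.
From mathcomp Require Import ring.
From mathcomp Require Import boolp classical_sets.

Set Implicit Arguments.
Unset Strict Implicit.
Unset Printing Implicit Defensive.

Import GRing.Theory.

Local Open Scope ring_scope.

(** Write [Gamma] for the [a]-torsion functor and [H^i(Gamma C)] for the
    cohomology of the torsion subcomplex of a complex [C] of injective modules.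
    The theorem is an instance of a statement about such complexes: if [C] is
    exact in all degrees [i > r] and all [H^i(Gamma C)] with [i > r] are minimax,
    then they are artinian.

    Let [b] lie in [a], and let [K] be the cone of multiplication by [b] on [C],
    again a complex of injectives.  The torsion of [K] is the cone of [b] on
    [Gamma C], which gives exact sequences

      [H^i(Gamma C) -b-> H^i(Gamma C) -> H^i+1(Gamma K) -> H^i+1(Gamma C)].

    Passing to cones on all the generators of [a] in turn leads to a complex
    whose cohomology is killed by powers of all the generators, hence is torsion.
    For such a complex the inclusion of [Gamma C] induces isomorphisms in
    cohomology ([torsion_cocycle_coboundary]), so the torsion of the last cone is
    exact in the relevant degrees.  This rests on a contraction of [C] modulo
    torsion, built degree by degree from injectivity and from a retraction of
    each injective module onto its torsion ([torsion_retraction]), which exists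
    because the ring is noetherian.

    From the last cone one returns to [C] one cone at a time.  If
    [H^i+1(Gamma K)] is artinian, then so is its submodule [H / b H], where
    [H = H^i(Gamma C)].  If [H] is minimax, with [F] finitely generated and
    [H / F] artinian, then some [b ^+ n] kills [F], as the elements of [H] are
    torsion; hence [b ^+ n H], a quotient of [H / F], is artinian.  These two
    facts make [H] artinian ([artinian_image_descent]).  The only consequence of
    minimaxity that is used, that [b ^+ n H] is artinian for some [n], passes to
    the cones by the long exact sequence ([artinian_image_exact]). *)

(** * Submodules as propositional predicates, quotients and extensions *)

Section Submodules.
Variables (R : comPzRingType) (V : lmodType R).
Implicit Types P : V -> Prop.

Record is_submodule P : Prop := IsSubmodule {
  is_submodule0 : P 0;
  is_submoduleD : forall u v, P u -> P v -> P (u + v);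
  is_submoduleZ : forall c v, P v -> P (c *: v)
}.

Lemma is_submoduleB P u v : is_submodule P -> P u -> P v -> P (u - v).
Proof.
move=> sP Pu Pv; rewrite -scaleN1r.
exact: is_submoduleD sP _ _ Pu (is_submoduleZ sP _ Pv).
Qed.

Lemma mem_is_submodule (N : submodClosed V) : is_submodule (fun v => v \in N).
Proof.
by split=> [|u v uN vN|c v vN]; [exact: rpred0|exact: rpredD|exact: rpredZ].
Qed.

Definition bool_submodule P & is_submodule P : {pred V} :=
  [pred v | `[< P v >]].

Lemma bool_submodule_closed P (sP : is_submodule P) :
  subsemimod_closed (bool_submodule sP).
Proof.
split; first split.
- by apply/asboolP; case: sP.
- move=> u v /asboolP Pu /asboolP Pv; apply/asboolP.
  exact: (is_submoduleD sP).
- by move=> c v /asboolP Pv; apply/asboolP; apply: (is_submoduleZ sP).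
Qed.

HB.instance Definition _ P (sP : is_submodule P) :=
  GRing.isSubmodClosed.Build R V (bool_submodule sP) (bool_submodule_closed sP).

Definition submodule_of P (sP : is_submodule P) : submodClosed V :=
  bool_submodule sP.

Lemma submodule_ofP P (sP : is_submodule P) v :
  reflect (P v) (v \in submodule_of sP).
Proof. exact: asboolP. Qed.

Lemma quotmod_proj_eq (N : submodClosed V) u v :
  quotmod_proj N u = quotmod_proj N v <-> u - v \in N.
Proof.
by rewrite -quotmod_projE; split=> [->|/eqP].
Qed.

End Submodules.

Definition bundle_linear (R : comPzRingType) (V W : lmodType R) (f : V -> W)
    (lf : linear f) : {linear V -> W} :=
  HB.pack f (GRing.isLinear.Build R V W *:%R f lf).

Section LinearMaps.
Variables (R : comPzRingType) (V W : lmodType R).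

Lemma quotmod_proj_is_linear (N : submodClosed V) : linear (quotmod_proj N).
Proof. by move=> c u v; rewrite quotmod_projD -quotmod_scaleE. Qed.

HB.instance Definition _ (N : submodClosed V) :=
  GRing.isLinear.Build R V (quotmod N) *:%R (quotmod_proj N)
    (quotmod_proj_is_linear N).

Lemma quotmod_factor (N : submodClosed V) (f : {linear V -> W}) :
  (forall v, v \in N -> f v = 0) ->
  exists g : {linear quotmod N -> W}, forall v, g (quotmod_proj N v) = f v.
Proof.
move=> fN0; pose g (q : quotmod N) := f (repr q).
have gE v : g (quotmod_proj N v) = f v.
  apply/subr0_eq; rewrite -linearB; apply: fN0.
  by apply/quotmod_proj_eq; rewrite quotmod_projK.
suff lg : linear g by exists (bundle_linear lg).
move=> c p q; rewrite -[p]quotmod_projK -[q]quotmod_projK.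
by rewrite -quotmod_proj_is_linear !gE linearP.
Qed.

End LinearMaps.

Lemma quotmod_proj_eq0 (R : comPzRingType) (V : lmodType R) (N : submodClosed V) v :
  quotmod_proj N v = 0 <-> v \in N.
Proof. by rewrite -(linear0 (quotmod_proj N)) quotmod_proj_eq subr0. Qed.

(** Dividing out the kernel of [f] turns it into an injection, to which the
    definition of injectivity applies. *)
Lemma injective_module_extend (R : comPzRingType) (E A B : lmodType R)
    (f : {linear A -> B}) (g : {linear A -> E}) :
  injective_module E -> (forall x, f x = 0 -> g x = 0) ->
  exists h : {linear B -> E}, forall x, h (f x) = g x.
Proof.
move=> injE kerfg.
have sK : is_submodule (fun x => f x = 0).
  split=> [|u v fu fv|c v fv]; first exact: linear0.
    by rewrite linearD fu fv addr0.
  by rewrite linearZ_LR fv scaler0.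
pose K := submodule_of sK.
have [f' f'E] : exists f' : {linear quotmod K -> B}, forall v, f' (quotmod_proj K v) = f v.
  by apply: quotmod_factor => v /submodule_ofP.
have [g' g'E] : exists g' : {linear quotmod K -> E}, forall v, g' (quotmod_proj K v) = g v.
  by apply: quotmod_factor => v /submodule_ofP /kerfg.
have f'inj : injective f'.
  move=> p q; rewrite -[p]quotmod_projK -[q]quotmod_projK !f'E => fpq.
  by apply/quotmod_proj_eq/submodule_ofP; rewrite linearB fpq subrr.
have [h hE] := injE _ _ f' g' f'inj.
by exists h => x; rewrite -f'E hE g'E.
Qed.

(** * Torsion over a noetherian ring *)

Lemma noetherian_acc (R : comPzRingType) (I : nat -> (R^o : lmodType R) -> Prop) :
  noetherian_ring R -> (forall k, is_submodule (I k)) ->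
  (forall k x, I k x -> I k.+1 x) ->
  exists m, forall k x, I k x -> I m x.
Proof.
move=> noethR sI incI.
have monoI k l x : (k <= l)%N -> I k x -> I l x.
  by move=> /subnK<- Ikx; elim: (l - k)%N => [//|n IHn]; apply: incI.
have sU : is_submodule (fun x => exists k, I k x).
  split; first by exists 0%N; case: (sI 0%N).
    move=> x y [k Ix] [l Iy]; exists (maxn k l).
    apply: (is_submoduleD (sI _)).
      exact: monoI (leq_maxl k l) Ix.
    exact: monoI (leq_maxr k l) Iy.
  by move=> c x [k Ix]; exists k; apply: (is_submoduleZ (sI _)).
have [s sgen] := noethR (submodule_of sU).
have /choice[k kP] (i : 'I_(size s)) : exists k, I k (val s`_i).
  by have /submodule_ofP := submod_valP s`_i.
exists (\max_i k i) => j x Ix.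
have xU : x \in submodule_of sU by apply/submodule_ofP; exists j.
have [c xE] := sgen (Submod xU).
rewrite -[x]/(val (Submod xU)) xE raddf_sum.
apply: big_ind => [|u v|i _].
- exact: (is_submodule0 (sI _)).
- exact: (is_submoduleD (sI _)).
apply: (is_submoduleZ (sI _) (c i) (v := val s`_i)).
exact: monoI (leq_bigmax i) (kP i).
Qed.

Section Torsion.
Variables (R : comPzRingType) (a : ideal R).

Definition generates (gens : seq R) : Prop :=
  (forall c, c \in gens -> c \in a) /\
  (forall y, y \in a -> exists e : 'I_(size gens) -> R,
     y = \sum_(i < size gens) e i * gens`_i).

Lemma noetherian_generates : noetherian_ring R -> exists gens, generates gens.
Proof.
move=> noethR; have [s sgen] := noethR a.
exists [seq val x | x <- s]; split=> [c /mapP[x _ ->]|y ya].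
  exact: submod_valP.
have [e yE] := sgen (Submod ya).
rewrite size_map; exists e; rewrite -[y]/(val (Submod ya)) yE raddf_sum; apply: eq_bigr => i _.
by rewrite (nth_map 0).
Qed.

Lemma exp_mem_ideal_exp c n : c \in a -> c ^+ n \in ideal_exp a n.
Proof.
move=> ca; elim: n => [|n IHn]; first by rewrite inE.
by apply/asboolP; exists [:: (c, c ^+ n)]; rewrite /= ?ca ?IHn ?big_seq1 ?exprS.
Qed.

Section OneModule.
Variable V : lmodType R.
Implicit Types v : V.

Lemma torsion_is_submodule : is_submodule (fun v => v \in @torsion_pred R a V).
Proof. exact: mem_is_submodule (@torsion_pred R a V). Qed.

Lemma torsion_of_generators gens v : generates gens ->
  (forall i : 'I_(size gens), gens`_i *: v \in @torsion_pred R a _) ->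
  v \in @torsion_pred R a _.
Proof.
move=> [_ gen_span] vtor.
have /choice[n nP] (i : 'I_(size gens)) : exists n, killed_by_pow a n (gens`_i *: v).
  by have /asboolP := vtor i.
apply/asboolP; exists (\max_i n i).+1 => _ /asboolP[s sP ->].
rewrite scaler_suml big_seq big1 // => p /(allP sP) /andP[/gen_span[e ->] p2].
rewrite mulr_suml scaler_suml big1 // => i _.
rewrite mulrAC -scalerA -scalerA (killed_by_powW (leq_bigmax i) (nP i)) //.
by rewrite scaler0.
Qed.

(** Torsion is detected one generator at a time: if [gens`_i ^+ m i] kills [v],
    multiplying by any generator lowers the sum of the exponents. *)
Lemma torsionP gens v : generates gens ->
  v \in @torsion_pred R a _ <->
  (forall c, c \in gens -> exists m, c ^+ m *: v = 0).
Proof.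
move=> gen; split=> [/asboolP[n vn] c cg|].
  by exists n; apply: vn; apply: exp_mem_ideal_exp; apply: (proj1 gen).
move=> vnil.
have /choice[m mP] (i : 'I_(size gens)) : exists m, gens`_i ^+ m *: v = 0.
  by apply: vnil; rewrite mem_nth.
have [N] := ubnP (\sum_i m i); elim: N => // N IHN in m v mP {vnil} *.
move=> mN.
have [[i mi0]|mpos] := pselect (exists i, m i = 0%N).
  rewrite -[v]scale1r -(expr0 gens`_i) -mi0 mP.
  exact: is_submodule0 torsion_is_submodule.
apply: torsion_of_generators gen _ => i.
have mi : (0 < m i)%N by rewrite lt0n; apply/eqP => mi0; apply: mpos; exists i.
apply: (IHN (fun j => if j == i then (m j).-1 else m j)) => [j|].
  case: eqP => [->|_]; first by rewrite scalerA -exprSr prednK.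
  by rewrite scalerA mulrC -scalerA mP scaler0.
rewrite ltnS in mN; apply: leq_trans mN.
rewrite (bigD1 i) //= eqxx [ltnRHS](bigD1 i) //= -addSn prednK // leq_add2l.
by apply: leq_sum => j /negPf ->.
Qed.

End OneModule.

Lemma torsion_linear (V W : lmodType R) (f : {linear V -> W}) v :
  v \in @torsion_pred R a _ -> f v \in @torsion_pred R a _.
Proof. by move=> vt; exact: torsion_mapP f (Submod vt). Qed.

(** Essential extensions of torsion modules over a noetherian ring are torsion,
    so modulo a submodule [K] maximal among those that meet the torsion
    trivially the module [E] becomes torsion; extending the inclusion of the
    torsion of [E] along its embedding into [E / K] gives the retraction. *)
Lemma torsion_retraction (E : lmodType R) :
  noetherian_ring R -> injective_module E ->
  exists rho : {linear E -> E},
    (forall x, rho x \in @torsion_pred R a _) /\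
    (forall x, x \in @torsion_pred R a _ -> rho x = x).
Proof.
move=> noethR injE; have [gens gen] := noetherian_generates noethR.
(* Zero is not required, so that the union of the empty chain qualifies. *)
pose disjoint_sub (K : set E) :=
  [/\ forall u v, K u -> K v -> K (u + v), forall c v, K v -> K (c *: v)
    & forall v, K v -> v \in @torsion_pred R a _ -> v = 0].
have [K [[KD KZ Kt] Kmax]] :
    exists K, disjoint_sub K /\ forall B, (K `<` B)%classic -> ~ disjoint_sub B.
  apply: Zorn_bigcup => F Fsub Ftot; split.
  - move=> u v [X FX Xu] [Y FY Yv].
    have [XY|YX] := Ftot _ _ FX FY.
      by exists Y => //; have [YD _ _] := Fsub _ FY; apply: YD => //; exact: XY.
    by exists X => //; have [XD _ _] := Fsub _ FX; apply: XD => //; exact: YX.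
  - by move=> c v [X FX Xv]; exists X => //; have [_ XZ _] := Fsub _ FX; exact: XZ.
  - by move=> v [X FX Xv]; have [_ _ Xt] := Fsub _ FX; exact: Xt.
have K0 : K 0.
  apply: contrapT => nK0; apply: (Kmax [set 0]%classic).
    split=> [v Kv|]; last by move=> /(_ 0 erefl).
    by case: nK0; rewrite -(scale0r v); apply: KZ.
  by split=> [_ _ -> ->|c _ ->|v ->] //=; rewrite ?addr0 ?scaler0.
have sK : is_submodule K by [].
have powK c x : c \in gens -> exists m, K (c ^+ m *: x).
  move=> cg; pose I m (r : R^o) := K (r *: (c ^+ m *: x)).
  have [m Im] : exists m, forall k r, I k r -> I m r.
    apply: noetherian_acc => // [k|k r]; last first.
      by move=> /(KZ c); rewrite /I exprS !scalerA mulrCA !mulrA.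
    split=> [|r s|e r]; rewrite /I ?scale0r //.
      by rewrite scalerDl; apply: KD.
    by rewrite -[e *: r]/(e * r) -scalerA; apply: KZ.
  exists m; apply: contrapT => nKx.
  apply: (Kmax (fun y => exists k r, K k /\ y = k + r *: (c ^+ m *: x))).
    split=> [y Ky|KB]; first by exists y, 0; rewrite scale0r addr0.
    by apply/nKx/KB; exists 0, 1; rewrite scale1r add0r.
  split.
  - move=> _ _ [k [r [Kk ->]]] [l [s [Kl ->]]]; exists (k + l), (r + s).
    by rewrite scalerDl addrACA; split=> //; apply: KD.
  - move=> e _ [k [r [Kk ->]]]; exists (e *: k), (e * r).
    by rewrite scalerDr -(scalerA e r); split=> //; apply: KZ.
  move=> _ [k [r [Kk ->]]] tor.
  have [p cp] := (torsionP _ gen).1 tor c cg.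
  apply: Kt tor; apply: KD => //; apply: (Im (m + p)%N); rewrite /I.
  (* [c ^+ p] kills [k + r *: (c ^+ m *: x)], whence [r] lies in [I (m + p)]. *)
  have -> : r *: (c ^+ (m + p) *: x) = - 1 *: (c ^+ p *: k).
    apply/eqP; rewrite scaleN1r -addr_eq0 -[X in _ == X]cp scalerDr addrC.
    by rewrite exprD !scalerA; apply/eqP; congr (_ + _ *: _); ring.
  exact: KZ (KZ _ _ Kk).
pose Q := submodule_of sK.
pose tval : {linear torsion a E -> E} := val.
pose emb : {linear torsion a E -> quotmod Q} := quotmod_proj Q \o tval.
have [h hE] : exists h : {linear quotmod Q -> E}, forall x, h (emb x) = tval x.
  apply: injective_module_extend injE _ => x embx0.
  apply: Kt (submod_valP x); apply/(submodule_ofP sK).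
  by apply/quotmod_proj_eq0.
exists (h \o quotmod_proj Q); split=> [x|x xt]; last exact: hE (Submod xt).
apply/(torsionP _ gen) => c cg; have [m Km] := powK c x cg; exists m.
rewrite -linearZ_LR /= -[RHS](linear0 h); congr (h _).
by apply/quotmod_proj_eq0/submodule_ofP.
Qed.

End Torsion.

(** * Artinian subquotients *)

Section ArtinianImage.
Variables (R : comPzRingType) (V W : lmodType R).

(** The descending chain condition for the image of [Z] under [f] in the
    quotient of [W] by [B]; working with chains of submodules of [W] that
    contain [B] keeps subquotients from becoming types. *)
Definition artinian_image (f : V -> W) (Z : V -> Prop) (B : W -> Prop) : Prop :=
  forall N : nat -> W -> Prop,
    (forall k, is_submodule (N k)) -> (forall k w, N k.+1 w -> N k w) ->
    (forall k w, B w -> N k w) ->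
    exists l, forall k v, (l <= k)%N -> Z v -> N l (f v) -> N k (f v).

Lemma decreasing_leq (N : nat -> W -> Prop) k l w :
  (forall k w, N k.+1 w -> N k w) -> (k <= l)%N -> N l w -> N k w.
Proof.
by move=> decN /subnK<-; elim: (l - k)%N => [//|n IHn]; rewrite addSn => /decN.
Qed.

End ArtinianImage.

Lemma artinian_image_pullback (R : comPzRingType) (V W : lmodType R)
    (f : {linear V -> W}) (x : R) (ZV BV : V -> Prop) (BW : W -> Prop) :
  (forall v, BV v -> BW (f v)) ->
  artinian_image (fun v : V => x *: v) ZV BV ->
  artinian_image (fun v => x *: f v) ZV BW.
Proof.
move=> fB artV N sN decN BN.
have [|||l lP] := artV (fun k v => N k (f v)).
- move=> k; split=> [|u v fu fv|c v fv].
  + by rewrite linear0; case: (sN k).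
  + by rewrite linearD; apply: (is_submoduleD (sN k)).
  + by rewrite linearZ_LR; apply: (is_submoduleZ (sN k)).
- by move=> k v; apply: decN.
- by move=> k v /fB; apply: BN.
by exists l => k v lk Zv; rewrite -linearZ_LR; apply: lP.
Qed.

(** For an exact sequence [V -> W -> U] of subquotients: if [x f(V)] and [y U]
    are artinian, so is [x y W].  With [x = y = 1] this is the usual extension
    property; the multipliers let the weaker condition that some power of a ring
    element has artinian image pass through exact sequences as well. *)
Lemma artinian_image_exact (R : comPzRingType) (V W U : lmodType R)
    (f : {linear V -> W}) (g : {linear W -> U}) (x y : R)
    (ZV : V -> Prop) (ZW BW : W -> Prop) (ZU BU : U -> Prop) :
  is_submodule ZW -> is_submodule BU ->
  (forall w, ZW w -> ZU (g w)) ->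
  (forall w, ZW w -> BU (g w) -> exists v, ZV v /\ BW (w - f v)) ->
  artinian_image (fun v => x *: f v) ZV BW ->
  artinian_image (fun u => y *: u) ZU BU ->
  artinian_image (fun w => (x * y) *: w) ZW BW.
Proof.
move=> sZW sBU gZ exactW artV artU N sN decN BN.
have [l1 l1P] := artV N sN decN BN.
pose M k u := exists w, [/\ ZW w, N k (x *: w) & BU (u - g w)].
have [|||l2 l2P] := artU M.
- move=> k; split.
  + exists 0; rewrite (linear0 g) scaler0 subr0.
    by split; [exact: is_submodule0|exact: is_submodule0 (sN k)|exact: is_submodule0].
  + move=> u u' [w [Zw Nw Bw]] [w' [Zw' Nw' Bw']]; exists (w + w'); split.
    * exact: is_submoduleD.
    * by rewrite scalerDr; apply: (is_submoduleD (sN k)).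
    * by rewrite (linearD g) opprD addrACA; apply: is_submoduleD.
  + move=> c u [w [Zw Nw Bw]]; exists (c *: w); split.
    * exact: is_submoduleZ.
    * rewrite scalerA mulrC -scalerA; exact: (is_submoduleZ (sN k)).
    * by rewrite (linearZ_LR g) -scalerBr; apply: is_submoduleZ.
- by move=> k u [w [Zw Nw Bw]]; exists w; split=> //; apply: decN.
- move=> k u Bu; exists 0; rewrite (linear0 g) scaler0 subr0.
  by split=> //; [exact: is_submodule0|exact: is_submodule0 (sN k)].
exists (maxn l1 l2) => k w; rewrite geq_max => /andP[l1k l2k] Zw Nw.
have ZyW : ZW (y *: w) by apply: is_submoduleZ.
have [w' [Zw' Nw' Bw']] : M k (y *: g w).
  apply: l2P => //; first exact: gZ.
  exists (y *: w); rewrite (linearZ_LR g) subrr; split=> //; last exact: is_submodule0.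
  by rewrite scalerA; apply: decreasing_leq Nw; rewrite // leq_maxr.
have [v [Zv Bv]] : exists v, ZV v /\ BW (y *: w - w' - f v).
  apply: exactW; first exact: is_submoduleB.
  by rewrite (linearB g) (linearZ_LR g).
have xBN j : N j (x *: (y *: w - w' - f v)).
  by apply: (is_submoduleZ (sN j)); apply: BN.
have Nkv : N k (x *: f v).
  apply: l1P => //.
  have -> : x *: f v = (x * y) *: w - x *: w' - x *: (y *: w - w' - f v).
    by rewrite -scalerA -!scalerBr opprB addrC subrK.
  apply: (is_submoduleB (sN l1)) (xBN l1).
  apply: (is_submoduleB (sN l1)); last exact: decreasing_leq Nw'.
  by apply: decreasing_leq Nw; rewrite // leq_maxl.
have -> : (x * y) *: w = x *: (y *: w - w' - f v) + x *: f v + x *: w'.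
  by rewrite -scalerDr -scalerDr !subrK scalerA.
by apply: (is_submoduleD (sN k)) => //; apply: (is_submoduleD (sN k)).
Qed.

(** If [H] denotes [Z / B], then [b ^+ j H / b ^+ j.+1 H] is a quotient of
    [H / b H], so the artinian property climbs down from [b ^+ n H] to [H]. *)
Lemma artinian_image_descent (R : comPzRingType) (V U : lmodType R)
    (g : {linear V -> U}) (b : R) n (ZV BV : V -> Prop) (ZU BU : U -> Prop) :
  is_submodule ZV -> is_submodule BU ->
  (forall v, ZV v -> ZU (g v)) ->
  (forall v, ZV v -> BU (g v) -> exists u, ZV u /\ BV (v - b *: u)) ->
  artinian_image (fun v => b ^+ n *: v) ZV BV ->
  artinian_image id ZU BU -> artinian_image id ZV BV.
Proof.
move=> sZV sBU gZ exactV artn artU.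
have lb : linear (fun v : V => b *: v).
  by move=> c u v; rewrite scalerDr !scalerA mulrC.
suff: artinian_image (fun v => b ^+ 0 *: v) ZV BV.
  by under eq_fun do rewrite scale1r.
elim: n artn => [//|n IHn] artn; apply: IHn.
rewrite -[b ^+ n]mulr1.
apply: (artinian_image_exact (f := bundle_linear lb) (g := g) (ZV := ZV) (ZU := ZU) (BU := BU)) => //=.
  by under eq_fun do rewrite scalerA -exprSr.
by under eq_fun do rewrite scale1r.
Qed.

(** A module [H] may be presented as a subquotient of [V] by any module [Y] that
    maps onto [H] and embeds into [V]. *)
Section Presentation.
Variables (R : comPzRingType) (V Y H : lmodType R).
Variables (p : {linear Y -> H}) (j : {linear Y -> V}) (Z B : V -> Prop).
Hypothesis p_surj : forall h, exists y, p y = h.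
Hypothesis j_inj : injective j.
Hypothesis ZP : forall v, Z v <-> exists y, v = j y.
Hypothesis BP : forall v, B v <-> exists2 y, p y = 0 & v = j y.

Lemma artinian_of_image : artinian_image id Z B -> artinian H.
Proof.
move=> artZ N decN; pose M k v := exists2 y, v = j y & p y \in N k.
have [|||l lP] := artZ M.
- move=> k; split=> [|_ _ [u -> Nu] [v -> Nv]|c _ [v -> Nv]].
  + by exists 0; rewrite linear0 ?rpred0.
  + by exists (u + v); rewrite linearD ?rpredD.
  + by exists (c *: v); rewrite linearZ_LR ?rpredZ.
- by move=> k _ [y -> Ny]; exists y => //; apply: decN.
- by move=> k _ /BP[y py0 ->]; exists y; rewrite ?py0 ?rpred0.
exists l => k lk h; apply/idP/idP.
  by apply: (@decreasing_leq _ _ (fun k h => h \in N k)) lk => i w; apply: decN.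
have [y <-] := p_surj h => Ny.
have [| |y' /j_inj -> //] := lP k (j y) lk; first by apply/ZP; exists y.
by exists y.
Qed.

(** A power of [b] kills the finitely generated part of [H], so multiplication by
    it factors through the artinian quotient. *)
Lemma minimax_artinian_image b : minimax H ->
  (forall h : H, exists n, b ^+ n *: h = 0) ->
  exists n, artinian_image (fun v : V => b ^+ n *: v) Z B.
Proof.
move=> [F [[s sgen] artF]] bnil.
have /choice[m mP] (i : 'I_(size s)) : exists m, b ^+ m *: s`_i = 0.
  have [m mP] := bnil (val s`_i).
  by exists m; apply: val_inj; exact: mP.
pose n := \max_i m i.
have bnF h : h \in F -> b ^+ n *: h = 0.
  move=> hF; have [c hE] := sgen (Submod hF).
  suff b0 : b ^+ n *: Submod hF = 0 by rewrite -[LHS]/(val (b ^+ n *: Submod hF)) b0.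
  rewrite hE scaler_sumr big1 // => i _.
  rewrite scalerA mulrC -scalerA -(subnK (leq_bigmax i : (m i <= n)%N)).
  by rewrite exprD -scalerA mP !scaler0.
exists n => N sN decN BN.
pose M k q := exists2 y, q = quotmod_proj F (p y) & N k (b ^+ n *: j y).
have sM k : is_submodule (M k).
  split=> [|_ _ [u -> Nu] [v -> Nv]|c _ [v -> Nv]].
  + by exists 0; rewrite ?linear0 //; apply: is_submodule0 (sN k).
  + exists (u + v); first by rewrite !linearD.
    by rewrite (linearD j) scalerDr; apply: (is_submoduleD (sN k)).
  + exists (c *: v); first by rewrite !linearZ_LR.
    by rewrite (linearZ_LR j) scalerA mulrC -scalerA; apply: (is_submoduleZ (sN k)).
have [|l lP] := artF (fun k => submodule_of (sM k)).
  by move=> k q /submodule_ofP[y -> Ny]; apply/submodule_ofP; exists y => //; apply: decN.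
exists l => k _ lk /ZP[y ->] Ny.
have /submodule_ofP[y' ppE Ny'] :
    quotmod_proj F (p y) \in submodule_of (sM k).
  by rewrite lP //; apply/submodule_ofP; exists y.
have Byy' : B (b ^+ n *: j y - b ^+ n *: j y').
  apply/BP; exists (b ^+ n *: (y - y')).
    by rewrite linearZ_LR; apply: bnF; rewrite linearB; apply/quotmod_proj_eq.
  by rewrite linearZ_LR linearB scalerBr.
rewrite -[X in N k X](subrK (b ^+ n *: j y')).
by apply: (is_submoduleD (sN k)) => //; apply: BN.
Qed.

End Presentation.

(** * Complexes and cones *)

Section Previous.
Variables (R : comPzRingType) (C : cochain_complex R).

(** Having a term in degree [-1] makes degree 0 a case like any other for
    coboundaries and cones. *)
Definition prev_obj (i : nat) : lmodType R :=
  if i is j.+1 then C j else 'rV[R]_0.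

Definition prev_diff (i : nat) : {linear prev_obj i -> C i} :=
  match i return {linear prev_obj i -> C i} with
  | 0 => \0%R
  | j.+1 => cdiff C j
  end.

Lemma cdiff_prev_diff i w : cdiff C i (prev_diff i w) = 0.
Proof. by case: i w => [|i] w; [exact: linear0|exact: cdiffK]. Qed.

Definition exact_at i : Prop :=
  forall z, cdiff C i z = 0 -> exists w, z = prev_diff i w.

Definition power_kills_cohomology (b : R) : Prop :=
  forall i z, cdiff C i z = 0 -> exists m w, b ^+ m *: z = prev_diff i w.

End Previous.

Section Cone.
Variables (R : comPzRingType) (b : R) (C : cochain_complex R).

Definition cone_obj (i : nat) : lmodType R := (C i * prev_obj C i)%type.

Definition cone_fun i (p : cone_obj i) : cone_obj i.+1 :=
  (cdiff C i p.1, b *: p.1 - prev_diff C i p.2).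

Lemma cone_fun_linear i : linear (@cone_fun i).
Proof.
move=> c [u v] [u' v']; congr pair; first exact: linearP.
rewrite /= (linearP (prev_diff C i)) scalerDr opprD addrACA.
by rewrite scalerA mulrC -scalerA -scalerBr.
Qed.

Definition cone_diff i : {linear cone_obj i -> cone_obj i.+1} :=
  bundle_linear (@cone_fun_linear i).

Lemma cone_diffK i (p : cone_obj i) : cone_diff i.+1 (cone_diff i p) = 0.
Proof.
case: p => u v; congr pair; first exact: cdiffK.
by rewrite /= linearB cdiff_prev_diff subr0 (linearZ_LR (cdiff C i)) subrr.
Qed.

(** The mapping cone of multiplication by [b] on [C], shifted by one degree so
    that it starts in degree 0. *)
Definition cone : cochain_complex R := CochainComplex cone_diffK.

Lemma cone_injective i : (forall k, injective_module (C k)) ->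
  injective_module (cone i).
Proof.
move=> injC A B f g injf.
have injP : injective_module (prev_obj C i).
  case: i {g} => [|i]; last exact: injC.
  by move=> A' B' f' g' _; exists \0%R => x; rewrite !thinmx0.
have l1 : linear (fun x => (g x).1) by move=> c u v; rewrite linearP.
have l2 : linear (fun x => (g x).2) by move=> c u v; rewrite linearP.
have [h1 h1E] := injC i _ _ f (bundle_linear l1) injf.
have [h2 h2E] := injP _ _ f (bundle_linear l2) injf.
have lh : linear (fun x => (h1 x, h2 x) : cone i).
  by move=> c u v; rewrite !linearP.
by exists (bundle_linear lh) => x /=; rewrite h1E h2E /=; case: (g x).
Qed.

(** Multiplication by [b] is null-homotopic on its own cone. *)
Lemma cone_self_kills : power_kills_cohomology cone b.
Proof.
move=> i [u v] duv; exists 1%N; rewrite expr1.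
have du : cdiff C i u = 0 := congr1 fst duv.
have /= buv : b *: u - prev_diff C i v = 0 := congr1 snd duv.
case: i u v du buv {duv} => [|i] u v du buv.
  exists 0; rewrite linear0; congr pair; last exact: thinmx0.
  exact: etrans (esym (subr0 _)) buv.
exists ((v, 0) : cone i); congr pair; first exact: subr0_eq.
by rewrite /= (linear0 (prev_diff C i)) subr0.
Qed.

(** The cocycle [(u, v)] with [u = d w] is cohomologous to [(0, v - b w)]. *)
Lemma cone_residue i (u : C i.+1) (v w : C i) :
  cdiff cone i.+1 (u, v) = 0 -> u = cdiff C i w ->
  cdiff C i (v - b *: w) = 0.
Proof.
move=> /(congr1 snd)/= /subr0_eq buv uw.
by rewrite linearB linearZ_LR -buv uw subrr.
Qed.

Lemma cone_boundary i (u : C i.+1) (v w : C i) (w' : prev_obj C i) :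
  u = cdiff C i w -> v - b *: w = prev_diff C i w' ->
  ((u, v) : cone i.+1) = cdiff cone i (w, - w').
Proof.
move=> -> vw; congr pair.
by rewrite /= linearN opprK -vw addrC subrK.
Qed.

Lemma cone_power_kills c :
  power_kills_cohomology C c -> power_kills_cohomology cone c.
Proof.
move=> cC [|i] [u v] duv.
  have [m [w uw]] := cC 0%N u (congr1 fst duv).
  exists m, 0; rewrite linear0; congr pair; last exact: thinmx0.
  by rewrite uw.
have [m [w uw]] := cC _ u (congr1 fst duv).
have dcuv : cdiff cone i.+1 (c ^+ m *: u, c ^+ m *: v) = 0.
  by rewrite -[X in cdiff _ _ X]/(c ^+ m *: ((u, v) : cone i.+1)) linearZ_LR duv scaler0.
have [k [w' ww']] := cC _ _ (cone_residue dcuv uw).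
exists (k + m)%N, ((c ^+ k *: w, - w') : cone i).
have -> : c ^+ (k + m) *: ((u, v) : cone i.+1) =
    (c ^+ k *: (c ^+ m *: u), c ^+ k *: (c ^+ m *: v)).
  by congr pair; rewrite /= scalerA exprD.
apply: cone_boundary; first by rewrite uw (linearZ_LR (cdiff C i)).
by rewrite -ww' scalerBr !scalerA [b * _]mulrC.
Qed.

Lemma cone_exact_at i : exact_at C i -> exact_at C i.+1 -> exact_at cone i.+1.
Proof.
move=> exi exi1 [u v] duv.
have [w uw] := exi1 u (congr1 fst duv).
have [w' ww'] := exi _ (cone_residue duv uw).
by exists (w, - w'); apply: cone_boundary.
Qed.

End Cone.

(** * Torsion of complexes of injectives *)

Section TorsionSubcomplex.
Variables (R : comPzRingType) (a : ideal R) (C : cochain_complex R).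

Definition torsion_cocycle i (z : C i) : Prop :=
  z \in @torsion_pred R a _ /\ cdiff C i z = 0.

Definition torsion_coboundary i (z : C i) : Prop :=
  exists2 w, w \in @torsion_pred R a _ & z = prev_diff C i w.

Lemma torsion_cocycle_submodule i : is_submodule (@torsion_cocycle i).
Proof.
have sT := torsion_is_submodule a (C i).
split=> [|u v [ut du] [vt dv]|c v [vt dv]].
- by split; [exact: is_submodule0 sT|exact: linear0].
- by split; [exact: (is_submoduleD sT)|rewrite linearD du dv addr0].
- by split; [exact: (is_submoduleZ sT)|rewrite linearZ_LR dv scaler0].
Qed.

Lemma torsion_coboundary_submodule i : is_submodule (@torsion_coboundary i).
Proof.
have sT := torsion_is_submodule a (prev_obj C i).
split=> [|_ _ [u ut ->] [v vt ->]|c _ [v vt ->]].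
- by exists 0; [exact: is_submodule0 sT|rewrite linear0].
- by exists (u + v); [exact: (is_submoduleD sT)|rewrite linearD].
- by exists (c *: v); [exact: (is_submoduleZ sT)|rewrite linearZ_LR].
Qed.

Hypothesis noethR : noetherian_ring R.
Hypothesis injC : forall i, injective_module (C i).

(** One step of a contraction of [C] modulo torsion: by injectivity of [C i] the
    error [y - d h y], pushed into the torsion-free part of [C i] by the
    projection [y - rho y], factors through [d]. *)
Lemma contraction_step gens i (h : {linear C i -> prev_obj C i}) :
  generates a gens -> (forall c, c \in gens -> power_kills_cohomology C c) ->
  (forall u, prev_diff C i u - prev_diff C i (h (prev_diff C i u))
     \in @torsion_pred R a _) ->
  exists h' : {linear C i.+1 -> C i}, forall y,
    y - prev_diff C i (h y) - h' (cdiff C i y) \in @torsion_pred R a _.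
Proof.
move=> gen killC hB.
have [rho [rho_tor rho_id]] := torsion_retraction a noethR (@injC i).
pose e y := y - prev_diff C i (h y).
have le : linear e.
  by move=> c u v; rewrite /e (linearP h) (linearP (prev_diff C i)) opprD addrACA scalerBr.
pose el := bundle_linear le.
have lg : linear (fun y => e y - rho (e y)).
  by move=> c u v; rewrite le (linearP rho) opprD addrACA -scalerBr.
have [h' h'E] : exists h' : {linear C i.+1 -> C i},
    forall y, h' (cdiff C i y) = bundle_linear lg y.
  apply: injective_module_extend (@injC i) _ => y dy /=.
  suff ety : e y \in @torsion_pred R a _ by rewrite rho_id // subrr.
  apply/(torsionP _ gen) => c cg; have [m [w mw]] := killC c cg i y dy.
  have /(torsionP _ gen)/(_ c cg)[k ck] : el (c ^+ m *: y) \in @torsion_pred R a _.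
    by rewrite mw; exact: hB.
  by exists (k + m)%N; rewrite exprD -scalerA -[_ *: e y](linearZ_LR el).
by exists h' => y; rewrite h'E /= opprB addrC subrK; exact: rho_tor.
Qed.

Lemma contraction gens :
  generates a gens -> (forall c, c \in gens -> power_kills_cohomology C c) ->
  forall i, exists (h : {linear C i -> prev_obj C i}) (h' : {linear C i.+1 -> C i}),
    forall y, y - prev_diff C i (h y) - h' (cdiff C i y) \in @torsion_pred R a _.
Proof.
move=> gen killC; elim=> [|i [h [h' hh']]].
  pose h : {linear C 0%N -> prev_obj C 0} := \0%R.
  have [|h' hP] := contraction_step (h := h) gen killC; last by exists h, h'.
  move=> u; rewrite (subrr (0 : C 0%N)); exact: is_submodule0 (torsion_is_submodule a (C 0%N)).
exists h'; apply: contraction_step gen killC _ => u.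
have := torsion_linear (cdiff C i) (hh' u).
by rewrite !linearB cdiff_prev_diff subr0.
Qed.

(** If the torsion cocycle [z] is [d y], it is also the boundary of
    [y - d (h y)], which by the contraction is torsion up to [h' z]. *)
Lemma torsion_cocycle_coboundary gens i z :
  generates a gens -> (forall c, c \in gens -> power_kills_cohomology C c) ->
  exact_at C i.+1 -> torsion_cocycle z -> torsion_coboundary (i := i.+1) z.
Proof.
move=> gen killC exC [zt /exC[/= y zE]].
have [h [h' hh']] := contraction gen killC i.
have sT := torsion_is_submodule a (C i).
exists (y - prev_diff C i (h y)).
  rewrite -[X in X \in _](subrK (h' (cdiff C i y))).
  apply: (is_submoduleD sT) (hh' y) _.
  by apply: torsion_linear; rewrite -zE.
by rewrite /= linearB cdiff_prev_diff subr0.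
Qed.

End TorsionSubcomplex.

(** * Descent along the cones *)

Section Descent.
Variables (R : comPzRingType) (a : ideal R).
Implicit Type C : cochain_complex R.

Definition cone_in b C i (v : C i) : cone b C i.+1 := (0, v).
Definition cone_out b C i (p : cone b C i) : C i := p.1.

Lemma cone_in_linear b C i : linear (@cone_in b C i).
Proof. by move=> c u v; congr pair; rewrite /= scaler0 addr0. Qed.

Lemma cone_out_linear b C i : linear (@cone_out b C i).
Proof. by []. Qed.

Lemma torsion_pair (V W : lmodType R) (v : V) (w : W) :
  ((v, w) : (V * W)%type) \in @torsion_pred R a _ <->
  v \in @torsion_pred R a _ /\ w \in @torsion_pred R a _.
Proof.
split=> [vw|[/asboolP[m vm] /asboolP[n wn]]].
  by split; [exact: (torsion_linear fst vw)|exact: (torsion_linear snd vw)].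
apply/asboolP; exists (maxn m n) => r ran; congr pair.
  exact: (killed_by_powW (leq_maxl m n) vm).
exact: (killed_by_powW (leq_maxr m n) wn).
Qed.

Lemma torsion_cocycle_cone b C i (u : C i.+1) (v : C i) :
  torsion_cocycle a (C := cone b C) (i := i.+1) (u, v) ->
  torsion_cocycle a u.
Proof.
by move=> [/torsion_pair[ut vt] duv]; split=> //; exact: (congr1 fst duv).
Qed.

(** The part [H^i(C) -> H^i+1(cone) -> H^i+1(C)] of the long exact sequence of
    the torsion subcomplexes. *)
Lemma cone_artinian_image b C i (x y : R) :
  artinian_image (fun v : C i => x *: v)
    (@torsion_cocycle R a C i) (@torsion_coboundary R a C i) ->
  artinian_image (fun v : C i.+1 => y *: v)
    (@torsion_cocycle R a C i.+1) (@torsion_coboundary R a C i.+1) ->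
  artinian_image (fun v : cone b C i.+1 => (x * y) *: v)
    (@torsion_cocycle R a (cone b C) i.+1)
    (@torsion_coboundary R a (cone b C) i.+1).
Proof.
move=> artx arty.
have sT V := torsion_is_submodule a V.
pose f := bundle_linear (@cone_in_linear b C i).
pose g := bundle_linear (@cone_out_linear b C i.+1).
apply: (artinian_image_exact (f := f) (g := g)
  (ZV := @torsion_cocycle R a C i) _ _ _ _ _ arty).
- exact: torsion_cocycle_submodule.
- exact: torsion_coboundary_submodule.
- by move=> [u v]; exact: torsion_cocycle_cone.
- move=> [u v] [/torsion_pair[ut vt] duv] [w wt uw]; exists (v - b *: w).
  have wt' : v - b *: w \in @torsion_pred R a _.
    by apply: (is_submoduleB (sT _)) => //; exact: (is_submoduleZ (sT _)).
  split; first by split=> //; exact: cone_residue duv uw.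
  exists ((w, 0) : cone b C i).
    by apply/torsion_pair; split=> //; exact: is_submodule0 (sT _).
  congr pair; first by rewrite /= subr0.
  by rewrite /= linear0 subr0 opprB addrC subrK.
apply: artinian_image_pullback artx => _ [w wt ->].
exists ((0, - w) : cone b C i).
  apply/torsion_pair; split; first exact: is_submodule0 (sT _).
  by rewrite -scaleN1r; exact: (is_submoduleZ (sT _)).
congr pair; first by rewrite /= (linear0 (cdiff C i)).
by rewrite /= scaler0 (linearN (prev_diff C i)) opprK add0r.
Qed.

(** The part [H^i(C) -> H^i(C) -> H^i+1(cone)], in which the first map is
    multiplication by [b]. *)
Lemma cone_descent b C i n :
  artinian_image (fun v : C i => b ^+ n *: v)
    (@torsion_cocycle R a C i) (@torsion_coboundary R a C i) ->
  artinian_image id (@torsion_cocycle R a (cone b C) i.+1)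
    (@torsion_coboundary R a (cone b C) i.+1) ->
  artinian_image id (@torsion_cocycle R a C i) (@torsion_coboundary R a C i).
Proof.
have sT V := torsion_is_submodule a V.
apply: (artinian_image_descent (g := bundle_linear (@cone_in_linear b C i))).
- exact: torsion_cocycle_submodule.
- exact: torsion_coboundary_submodule.
- move=> v [vt dv]; split.
    by apply/torsion_pair; split=> //; exact: is_submodule0 (sT _).
  congr pair; first by rewrite /= (linear0 (cdiff C i.+1)).
  by rewrite /= dv scaler0 subr0.
move=> v [vt dv] [[u w] /torsion_pair[ut wt] uw].
exists u; split; first by split=> //; exact: esym (congr1 fst uw).
exists (- w); first by rewrite -scaleN1r; exact: (is_submoduleZ (sT _)).
by rewrite [v](congr1 snd uw) /= linearN addrC addrA addNr add0r.
Qed.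

(** The cones on the generators in [s] make the cohomology torsion, whence the
    torsion subcomplex of the last cone is exact; from there the artinian
    property descends one cone at a time. *)
Lemma artinian_of_powers (gens s : seq R) C r :
  noetherian_ring R -> generates a gens -> {subset s <= gens} ->
  (forall i, injective_module (C i)) ->
  (forall c, c \in gens -> c \notin s -> power_kills_cohomology C c) ->
  (forall i, (r < i)%N -> exact_at C i) ->
  (forall c i, c \in gens -> (r < i)%N -> exists n,
     artinian_image (fun v : C i => c ^+ n *: v)
       (@torsion_cocycle R a C i) (@torsion_coboundary R a C i)) ->
  forall i, (r < i)%N ->
    artinian_image id (@torsion_cocycle R a C i) (@torsion_coboundary R a C i).
Proof.
move=> noethR gen; elim: s => [|b s IHs] in C r *.
  move=> _ injC killC exC _ [//|i] ri N sN decN BN.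
  exists 0%N => k v _ Zv _; apply: BN.
  have kill c : c \in gens -> power_kills_cohomology C c by move=> cg; exact: killC.
  exact: (torsion_cocycle_coboundary noethR injC gen kill (exC _ ri) Zv).
move=> sgens injC killC exC artC i ri.
have bg : b \in gens by apply: sgens; rewrite mem_head.
have [n artn] := artC b i bg ri.
apply: cone_descent artn _; apply: (IHs (cone b C) r.+1) => //.
- by move=> c cs; apply: sgens; rewrite inE cs orbT.
- by move=> k; apply: cone_injective.
- move=> c cg cs; have [->|cb] := eqVneq c b; first exact: cone_self_kills.
  by apply: cone_power_kills; apply: killC; rewrite // inE negb_or cb.
- by move=> [//|k] rk; apply: cone_exact_at; apply: exC; rewrite // ltnW.
move=> c [//|k] cg rk.
have [m artm] := artC c k cg rk.
have [p artp] := artC c k.+1 cg (ltnW rk).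
by exists (m + p)%N; rewrite exprD; apply: cone_artinian_image.
Qed.

End Descent.

(** * Local cohomology *)

Lemma is_coboundary_torsion (R : comPzRingType) (a : ideal R)
    (C : cochain_complex R) i (x : torsion_complex a C i) :
  is_coboundary x <-> torsion_coboundary a (C := C) (i := i) (val x).
Proof.
case: i x => [|i] x; split.
- by move=> ->; exists 0 => //; exact: is_submodule0 (torsion_is_submodule _ _).
- by case=> w _ xE; apply: val_inj.
- by case=> y ->; exists (val y) => //; exact: submod_valP.
- by case=> w wt xE; exists (Submod wt); apply: val_inj.
Qed.

Section LocalCohomology.
Variables (R : comPzRingType) (a : ideal R) (M : lmodType R).
Variables (E : injective_resolution M) (i : nat).

Let C := torsion_complex a E.

Definition cocycle_class : {linear cocycles C i -> local_cohomology a E i} :=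
  quotmod_proj (@coboundary_pred R C i).

Definition cocycle_value : {linear cocycles C i -> E i} :=
  (val : {linear torsion a (E i) -> E i}) \o (val : {linear cocycles C i -> C i}).

Lemma cocycle_class_surj h : exists y, cocycle_class y = h.
Proof. by exists (repr h); exact: quotmod_projK. Qed.

Lemma cocycle_value_inj : injective cocycle_value.
Proof. by move=> y z /val_inj/val_inj. Qed.

Lemma torsion_cocycleP v :
  torsion_cocycle a (C := E) (i := i) v <-> exists y, v = cocycle_value y.
Proof.
split=> [[vt dv]|[y ->]]; last first.
  have /eqP dy := submod_valP y.
  by split; [exact: submod_valP (val y)|exact: (congr1 val dy)].
pose v' : C i := Submod vt.
have yc : v' \in @cocycle_pred R C i by apply/eqP/val_inj.
by exists (Submod yc).
Qed.

Lemma torsion_coboundaryP v :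
  torsion_coboundary a (C := E) (i := i) v <->
  exists2 y, cocycle_class y = 0 & v = cocycle_value y.
Proof.
split=> [vB|[y /quotmod_proj_eq0/asboolP/is_coboundary_torsion yB ->]]; last first.
  exact: yB.
have [y vE] : exists y, v = cocycle_value y.
  apply/torsion_cocycleP; have [w wt ->] := vB.
  by split; [exact: torsion_linear|exact: cdiff_prev_diff].
exists y => //; apply/quotmod_proj_eq0/asboolP/is_coboundary_torsion.
by rewrite vE in vB.
Qed.

Lemma torsion_class_nilpotent b h : b \in a ->
  exists n, b ^+ n *: (h : local_cohomology a E i) = 0.
Proof.
move=> ba; have [y <-] := cocycle_class_surj h.
have /asboolP[n yn] := submod_valP (val y).
exists n; rewrite -linearZ_LR; suff -> : b ^+ n *: y = 0 by rewrite linear0.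
by do 2!apply: val_inj; apply: yn; apply: exp_mem_ideal_exp.
Qed.

End LocalCohomology.

Theorem theorem2p3 (R : comPzRingType) (a : ideal R) (M : lmodType R)
    (E : injective_resolution M) (r : nat) :
  noetherian_ring R ->
  fin_gen M ->
  (1 <= r)%N ->
  (forall i : nat, (r <= i)%N -> minimax (local_cohomology a E i)) ->
  forall i : nat, (r <= i)%N -> artinian (local_cohomology a E i).
Proof.
move=> noethR _ r_gt0 minH i ri.
have [gens gen] := noetherian_generates a noethR.
apply: (artinian_of_image (@cocycle_class_surj _ a _ E i)
  (@cocycle_value_inj _ a _ E i) (@torsion_cocycleP _ a _ E i)
  (@torsion_coboundaryP _ a _ E i)).
case: r => [//|r] in r_gt0 minH ri *.
apply: (artinian_of_powers noethR gen (s := gens)) (ri) => //.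
- exact: ires_injective.
- by move=> c cg /negP.
- by move=> [//|k] _ z /ires_exactS.
move=> c k cg rk.
apply: (minimax_artinian_image (@torsion_cocycleP _ a _ E k)
  (@torsion_coboundaryP _ a _ E k) (b := c)); first exact: minH.
by move=> h; apply: torsion_class_nilpotent; apply: (proj1 gen).
Qed.
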